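(* Let $G$ be an embedded graph with embedded medial graph $G_m$. Then the set of cycle family graphs of $G_m$ is precisely the set of all twisted duals of $G$, i.e. $$\mathcal{C}(G_m)=\mathrm{Orb}(G).$$
   Context: Embedded graphs. An embedded graph is a finite graph (loops and multiple edges allowed) cellularly embedded in a closed, possibly non-orientable, surface. Equivalently, it is a ribbon graph: a surface with boundary that is a union of a set of vertex discs and a set of edge discs, meeting in disjoint line segments, each segment on the boundary of exactly one vertex disc and one edge disc, each edge disc containing exactly two segments. Equivalently, it is an arrow presentation: a set of circles with disjoint labelled arrows on them, each label appearing on exactly two arrows, up to relabelling pairs and reversing both arrows of a given label. Circles correspond to vertex discs; for each label $e$ an edge disc $e$ is attached by orienting its boundary, choosing two disjoint boundary arcs directed accordingly, and identifying these with the two $e$-labelled arrows respecting directions. Embedded graphs are considered up to isomorphism (homeomorphism preserving the vertex-edge structure), written $=$. Twisted duality. For an edge $e$ of $G$ (given as an arrow presentation): the half-twist $G^{\tau(e)}$ is obtained by reversing exactly one of the two $e$-labelled arrows; the dual with respect to $e$, $G^{\delta(e)}$, is obtained as follows: if $A,B$ are the two $e$-labelled arrows, add a segment with an $e$-labelled arrow directed from the head of $A$ to the tail of $B$, and a segment with an $e$-labelled arrow directed from the head of $B$ to the tail of $A$, and delete $A$ and $B$ together with the arcs containing them. These satisfy $\tau^2=\delta^2=(\tau\delta)^3=1$ on each edge, operations on different edges commute, and words act by $G^{\xi\zeta(e)}=(G^{\zeta(e)})^{\xi(e)}$; so $\mathfrak{G}=\langle\delta,\tau\mid\delta^2,\tau^2,(\tau\delta)^3\rangle\cong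 S_3$ acts at each edge. $H$ is a twisted dual of $G$ if it is obtained from $G$ by applying some element of $\mathfrak{G}$ at each edge. $\mathrm{Orb}(G)$ is the set of all twisted duals of $G$. Medial graphs. The medial graph $G_m$ of a cellularly embedded graph $G$ is the 4-regular embedded graph in the same surface with a vertex $v_e$ of degree 4 on each edge $e$ of $G$ and edges drawn by following the face boundaries of $G$. By convention an isolated vertex of $G$ gives an ''isolated face'' (a vertexless closed curve) in $G_m$, which is carried along as an arrowless circle in every graph state. Cycle family graphs. Let $F$ be a 4-regular embedded graph. A vertex state at $v$ is a choice of one of the three pairings of the four half-edges at $v$, where $v$ is replaced by two arcs joining the paired half-edges. An arrow marked vertex state is a vertex state with one $v$-labelled arrow on each of the two arcs, each pointing in either direction. An arrow marked graph state $\vec{s}$ is a choice of arrow marked vertex state at each vertex. The resulting closed curves with their arrows form an arrow presentation, whose embedded graph is denoted $F_{\vec{s}}$ and called a cycle family graph of $F$. $\mathcal{C}(F)$ is the set of all cycle family graphs of $F$. *)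

(* Defs.v *)
From HB Require Import structures.
From mathcomp Require Import all_boot all_fingroup.

Set Implicit Arguments.
Unset Strict Implicit.
Unset Printing Implicit Defensive.

(* Embedded graphs are given by arrow presentations.  The labels are the      *)
(* edges, the arrows are the half-edges, and the circles are the vertices.    *)

Record arrow_set := ArrowSet {
  label : finType;
  arrow : finType;
  lab : arrow -> label;
  card_lab : forall e : label, #|[set a | lab a == e]| = 2
}.

(* The two ends of an arrow a are its tail (a, false) and its head (a, true). *)
Definition end_of (A : arrow_set) : finType := (arrow A * bool)%type.

(* Up to homeomorphism, a set of circles carrying disjoint arrows is          *)
(* determined by the arcs left when the arrows are removed from the circles,  *)
(* and by the number of circles without arrows.  Each arc joins two distinct  *)
(* arrow ends: [arc x] is the end joined to x.                                *)
Record circles (A : arrow_set) := Circles {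
  arc : end_of A -> end_of A;
  arcK : involutive arc;
  arc_neq : forall x, arc x != x;
  bare : nat
}.

Record arrow_pres := ArrowPres {
  arrows :> arrow_set;
  circ : circles arrows
}.

(* Isomorphism of embedded graphs: homeomorphism of arrow presentations, up   *)
(* to relabelling (fL) and up to reversing both arrows of each label in r.    *)
(* Arcs are not directed, so reversing a circle is included.                  *)
Definition isomorphic (P Q : arrow_pres) : Prop :=
  exists (fL : label P -> label Q) (fA : arrow P -> arrow Q)
         (r : label P -> bool),
    [/\ bijective fL, bijective fA,
        forall a, lab (fA a) = fL (lab a),
        forall x : end_of P,
          let f (y : end_of P) : end_of Q := (fA y.1, y.2 (+) r (lab y.1)) in
          arc (circ Q) (f x) = f (arc (circ P) x)
      & bare (circ P) = bare (circ Q)].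

Section ArrowSets.
Variable A : arrow_set.
Implicit Types (a b : arrow A) (e : label A) (C : circles A).

(* The other arrow with the same label. *)
Definition mate a : arrow A :=
  odflt a [pick b | (lab b == lab a) && (b != a)].

Lemma mateP a : (lab (mate a) == lab a) && (mate a != a).
Proof.
rewrite /mate; case: pickP => [b //|no_b].
have := card_lab (lab a); rewrite (cardsD1 a) inE eqxx add1n => -[card1].
have /card_gt0P[b] : 0 < #|[set b | lab b == lab a] :\ a| by rewrite card1.
by rewrite !inE andbC no_b.
Qed.

Lemma lab_mate a : lab (mate a) = lab a.
Proof. by have /andP[/eqP] := mateP a. Qed.

Lemma mate_neq a : mate a != a.
Proof. by have /andP[_] := mateP a. Qed.

Lemma mate_uniq a b : lab b = lab a -> b != a -> b = mate a.
Proof.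
move=> lab_b neq_ba; apply/eqP; apply: contraT => neq_bm.
have := card_lab (lab a).
rewrite (cardsD1 a) inE eqxx (cardsD1 b) !inE neq_ba lab_b eqxx.
rewrite (cardsD1 (mate a)) !inE mate_neq lab_mate eqxx.
by rewrite eq_sym neq_bm.
Qed.

Lemma mateK : involutive mate.
Proof.
move=> a; symmetry; apply: mate_uniq; first by rewrite lab_mate.
by rewrite eq_sym mate_neq.
Qed.

Lemma label_arrow e : exists a, lab a == e.
Proof.
have /card_gt0P[a] : 0 < #|[set a | lab a == e]| by rewrite card_lab.
by rewrite inE; exists a.
Qed.

(* One of the two arrows labelled e; up to reversing both of them, it does    *)
(* not matter which one is reversed in a half-twist.                          *)
Definition arrow_at e : arrow A := xchoose (label_arrow e).

(* If new arrows are placed so that the new end x lies at the point of the    *)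
(* old end f x, the new ends are joined by the arcs below.                    *)
Section Replace.
Variables (f : {perm end_of A}) (C : circles A).

Definition replaced_arc (x : end_of A) : end_of A := (f^-1)%g (arc C (f x)).

Lemma replaced_arcK : involutive replaced_arc.
Proof. by move=> x; rewrite /replaced_arc permKV arcK permK. Qed.

Lemma replaced_arc_neq x : replaced_arc x != x.
Proof. by rewrite /replaced_arc (can2_eq (permKV f) (permK f)) arc_neq. Qed.

Definition replace_arrows : circles A :=
  Circles replaced_arcK replaced_arc_neq (bare C).

End Replace.

Definition half_twist e C : circles A :=
  replace_arrows (tperm (arrow_at e, false) (arrow_at e, true)) C.

(* The new arrow named a goes from the head of the old arrow a to the tail of *)
(* the old arrow mate a.                                                      *)
Definition dual_end e (x : end_of A) : end_of A :=
  if lab x.1 == e then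
    if x.2 then (mate x.1, false) else (x.1, true)
  else x.

Lemma dual_end_inj e : injective (dual_end e).
Proof.
move=> [a s] [b t]; rewrite /dual_end /=.
case: eqP => [ae|ae]; case: eqP => [be|be] //.
- by case: s t => [] [] // [] => [/(can_inj mateK) ->|->].
- by case: s => -[eq_ab]; case: be; rewrite -eq_ab ?lab_mate.
- by case: t => -[eq_ab]; case: ae; rewrite eq_ab ?lab_mate.
Qed.

Definition partial_dual e C : circles A :=
  replace_arrows (perm (@dual_end_inj e)) C.

End ArrowSets.

(* Elements of the group <delta, tau | delta^2, tau^2, (tau delta)^3> are     *)
(* represented by words in the generators, which act from right to left.      *)
Inductive generator := Delta | Tau.

Definition act_generator (A : arrow_set) (e : label A) (g : generator) :
  circles A -> circles A :=
  match g with Delta => partial_dual e | Tau => half_twist e end.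

Definition act_word (A : arrow_set) (e : label A) (w : seq generator)
  (C : circles A) : circles A :=
  foldr (act_generator e) C w.

Definition twist_all (P : arrow_pres) (w : label P -> seq generator) :
  arrow_pres :=
  ArrowPres (foldr (fun e => act_word e (w e)) (circ P) (enum (label P))).

Definition Orb (P H : arrow_pres) : Prop :=
  exists w : label P -> seq generator, isomorphic H (twist_all w).

(* The set of arrows on the circle containing the arrow a. *)
Definition vertex_of (P : arrow_pres) (a : arrow P) : {set arrow P} :=
  [set b | connect
     (fun x y : end_of P => (y == (x.1, ~~ x.2)) || (y == arc (circ P) x))
     (a, false) (b, false)].

(* The circles without arrows are the isolated vertices, which a 4-regular    *)
(* graph does not have; [loose] counts vertexless closed curves instead.      *)
Record four_regular := FourRegular {
  graph :> arrow_pres;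
  regular4 : forall a : arrow graph, #|vertex_of a| = 4;
  no_isolated : bare (circ graph) = 0;
  loose : nat
}.

Section CycleFamily.
Variable F : four_regular.

(* A pairing of the half-edges at each vertex of F, with one arrow on each of *)
(* the resulting arcs {h, pair h}: it points away from the one of h and       *)
(* pair h that satisfies [at_tail].                                           *)
Record arrow_state := ArrowState {
  pair : arrow F -> arrow F;
  pairK : involutive pair;
  pair_neq : forall h, pair h != h;
  pair_vertex : forall h, vertex_of (pair h) = vertex_of h;
  at_tail : pred (arrow F);
  at_tail_pair : forall h, at_tail (pair h) = ~~ at_tail h
}.

Variable s : arrow_state.

Definition vertex_label : finType :=
  {v : {set arrow F} | v \in [set vertex_of h | h : arrow F]}.

(* Each arrow of the state is named after the half-edge at its tail. *)
Definition state_arrow : finType := {h : arrow F | at_tail s h}.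

Definition state_lab (a : state_arrow) : vertex_label :=
  exist _ (vertex_of (val a)) (imset_f _ isT).

Lemma mem_vertex_of (a b : arrow F) :
  (b \in vertex_of a) = (vertex_of b == vertex_of a).
Proof.
set R := fun x y : end_of F => (y == (x.1, ~~ x.2)) || (y == arc (circ F) x).
have symR : connect_sym R.
  apply: sym_connect_sym => x y; rewrite /R; congr (_ || _).
    by apply/eqP/eqP => ->; rewrite /= negbK -surjective_pairing.
  by apply/eqP/eqP => ->; rewrite arcK.
apply/idP/eqP => [|<-]; last by rewrite inE connect0.
rewrite inE -/R => ab; apply/setP=> c; rewrite !inE -/R.
by rewrite (same_connect symR ab).
Qed.

Lemma card_state_lab (v : vertex_label) :
  #|[set a : state_arrow | state_lab a == v]| = 2.
Proof.
case: v => v v_in; have /imsetP[h0 _ def_v] := v_in.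
pose T := [set h | (h \in v) && at_tail s h].
pose N := [set h | (h \in v) && ~~ at_tail s h].
have -> : #|[set a : state_arrow | state_lab a == exist _ v v_in]| = #|T|.
  rewrite -(card_imset _ val_inj); congr #|pred_of_set _|.
  apply/setP=> h; rewrite inE; apply/imsetP/andP=> [[a]|[hv ht]].
    rewrite inE -val_eqE /= => /eqP av ->; split; last exact: (valP a).
    by rewrite -av mem_vertex_of.
  exists (exist _ h ht) => //; rewrite inE -val_eqE /=.
  by rewrite def_v -mem_vertex_of -def_v.
have NT : N = [set pair s h | h in T].
  apply/setP=> h; rewrite inE; apply/andP/imsetP=> [[hv ht]|[k]].
    exists (pair s h); last by rewrite pairK.
    rewrite inE at_tail_pair ht def_v mem_vertex_of pair_vertex.
    by rewrite -mem_vertex_of -def_v hv.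
  rewrite inE => /andP[kv kt] ->; rewrite at_tail_pair kt; split=> //.
  by rewrite def_v mem_vertex_of pair_vertex -mem_vertex_of -def_v.
have cardN : #|N| = #|T| by rewrite NT card_imset //; apply: (can_inj (@pairK s)).
have : #|v| = 4 by rewrite def_v regular4.
rewrite -(cardsID [set h | at_tail s h] v).
have -> : v :&: [set h | at_tail s h] = T by apply/setP=> h; rewrite !inE.
have -> : v :\: [set h | at_tail s h] = N.
  by apply/setP=> h; rewrite !inE andbC.
by rewrite cardN; case: #|T| => [|[|[|k]]] //; rewrite !addSn !addnS.
Qed.

Definition state_arrows : arrow_set := ArrowSet card_state_lab.

Definition half_edge_of (x : end_of state_arrows) : arrow F :=
  if x.2 then pair s (val x.1) else val x.1.

Lemma not_at_tail (h : arrow F) : at_tail s h = false -> at_tail s (pair s h).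
Proof. by rewrite at_tail_pair => ->. Qed.

Definition end_at (h : arrow F) : end_of state_arrows :=
  (if at_tail s h as b return at_tail s h = b -> end_of state_arrows
   then fun tl => (exist _ h tl, false)
   else fun hd => (exist _ (pair s h) (not_at_tail hd), true)) erefl.

Lemma end_atK : cancel end_at half_edge_of.
Proof.
move=> h; rewrite /end_at; move: (erefl (at_tail s h)).
by case: {2 3}(at_tail s h) => E; rewrite /half_edge_of //= pairK.
Qed.

Lemma half_edge_of_inj : injective half_edge_of.
Proof.
have key h k : at_tail s h -> at_tail s k -> pair s h <> k.
  by move=> ht kt E; move: kt; rewrite -E at_tail_pair ht.
move=> [[h ht] i] [[k kt] j]; rewrite /half_edge_of /=.
case: i; case: j => eq_hk.
- by congr (_, _); apply: val_inj => /=; apply: (can_inj (@pairK s)).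
- by case: (key h k).
- by case: (key k h).
- by congr (_, _); apply: val_inj.
Qed.

(* The arcs between the arrows of the state are the edges of F. *)
Definition state_arc (x : end_of state_arrows) : end_of state_arrows :=
  end_at (mate (half_edge_of x)).

Lemma state_arcK : involutive state_arc.
Proof.
by move=> x; apply: half_edge_of_inj; rewrite /state_arc !end_atK mateK.
Qed.

Lemma state_arc_neq x : state_arc x != x.
Proof.
apply/eqP=> /(congr1 half_edge_of) /eqP; rewrite end_atK.
by rewrite (negbTE (mate_neq _)).
Qed.

Definition cycle_family_graph : arrow_pres :=
  ArrowPres (Circles state_arcK state_arc_neq (loose F)).

End CycleFamily.

Definition Cyc (F : four_regular) (H : arrow_pres) : Prop :=
  exists s : arrow_state F, isomorphic H (cycle_family_graph s).

Section Medial.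
Variable G : arrow_pres.

Local Notation flag := (end_of G).
Local Notation arcG := (arc (circ G)).

(* The edges of the medial graph are the corners of G, that is, its arcs, and *)
(* its half-edges are the arrow ends of G.                                    *)
Definition corner : finType :=
  {c : {set flag} | c \in [set [set x; arcG x] | x : flag]}.

Definition corner_of (x : flag) : corner :=
  exist _ [set x; arcG x] (imset_f _ isT).

Lemma card_corner (c : corner) : #|[set x : flag | corner_of x == c]| = 2.
Proof.
case: c => c c_in; have /imsetP[y _ def_c] := c_in.
have -> : [set x | corner_of x == exist _ c c_in] = [set y; arcG y].
  apply/setP=> x; rewrite inE -val_eqE /= def_c.
  apply/eqP/set2P=> [eq_xy|[->|->]] //.
    by apply/set2P; rewrite -eq_xy set21.
  by rewrite arcK setUC.
by rewrite cards2 eq_sym arc_neq.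
Qed.

Definition medial_arrows : arrow_set := ArrowSet card_corner.

(* At the medial vertex on the edge e, the four half-edges are the ends of    *)
(* the two arrows A, B labelled e.  Two of them are consecutive around the    *)
(* vertex either across an end of e ([across]: the two ends of one arrow) or  *)
(* across a side of the edge disc of e ([along]: sides join the head of A to  *)
(* the tail of B and the head of B to the tail of A).                         *)
Definition across (x : flag) : flag := (x.1, ~~ x.2).
Definition along (x : flag) : flag := (mate x.1, ~~ x.2).

(* A medial edge has a vertex of G on one side and a face of G on the other.  *)
(* Following the boundary of its edge disc, one goes from the vertex side to  *)
(* the face side at one of its ends and back at the other, so exactly one of  *)
(* its two arrows x and arc x has its tail on the vertex side: the one which  *)
(* satisfies [tail_on_vertex_side], chosen arbitrarily.                       *)
Definition tail_on_vertex_side (x : flag) : bool :=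
  enum_rank x < enum_rank (arcG x).

Definition on_vertex_side (y : end_of medial_arrows) : bool :=
  y.2 (+) tail_on_vertex_side y.1.

Definition medial_arc (y : end_of medial_arrows) : end_of medial_arrows :=
  let x' := if on_vertex_side y then across y.1 else along y.1 in
  (x', on_vertex_side y (+) tail_on_vertex_side x').

Lemma medial_arcK : involutive medial_arc.
Proof.
move=> [[a i] j]; set x : flag := (a, i).
have acrossK : across (across x) = x by rewrite /across negbK.
have alongK : along (along x) = x by rewrite /along /= mateK negbK.
rewrite /medial_arc /on_vertex_side; cbn [fst snd].
case Ej: (j (+) tail_on_vertex_side x);
  by rewrite addbK ?acrossK ?alongK -[in RHS](addbK (tail_on_vertex_side x) j) Ej.
Qed.

Lemma medial_arc_neq y : medial_arc y != y.
Proof.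
case: y => [[a i] j]; apply/eqP; rewrite /medial_arc /across /along.
by case: (on_vertex_side _) => -[]; case: i.
Qed.

Definition medial_pres : arrow_pres :=
  ArrowPres (Circles medial_arcK medial_arc_neq 0).

Lemma medial_regular4 (h : arrow medial_pres) : #|vertex_of h| = 4.
Proof.
set R := fun x y : end_of medial_pres =>
  (y == (x.1, ~~ x.2)) || (y == arc (circ medial_pres) x).
have flipR (x : flag) i j : connect R (x, i) (x, j).
  have [->|] := eqVneq i j; first exact: connect0.
  by case: i; case: j => // _; apply: connect1; rewrite /R eqxx.
have acrossR (x : flag) i : connect R (x, i) (across x, i).
  apply: connect_trans (flipR x i (~~ tail_on_vertex_side x)) _.
  apply: connect_trans (connect1 _) (flipR (across x) _ i); last first.
    apply/orP; right; apply/eqP.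
    by rewrite /= /medial_arc /on_vertex_side /= addNb addbb.
have alongR (x : flag) i : connect R (x, i) (along x, i).
  apply: connect_trans (flipR x i (tail_on_vertex_side x)) _.
  apply: connect_trans (connect1 _) (flipR (along x) _ i); last first.
    apply/orP; right; apply/eqP.
    by rewrite /= /medial_arc /on_vertex_side /= addbb.
have labR x y : connect R x y -> @lab G x.1.1 = @lab G y.1.1.
  case/connectP=> p; elim: p x => [|z p IHp] x /=; first by move=> _ ->.
  case/andP=> Rxz pz last_y; rewrite -(IHp z pz last_y).
  case/orP: Rxz => /eqP -> //; rewrite /= /medial_arc /across /along /=.
  by case: ifP => //=; rewrite lab_mate.
case: h => a i.
have -> : @vertex_of medial_pres (a, i)
  = setX [set b | lab b == lab a] [set: bool].
  apply/setP=> -[b j]; rewrite !inE andbT -/R.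
  apply/idP/eqP=> /= [/labR /= -> //|lab_b].
  have {}flip c k l m : connect R (c, k, m) (c, l, m).
    have [->|] := eqVneq k l; first exact: connect0.
    by have := acrossR (c, k) m; rewrite /across /=; case: k; case: l.
  have [->|neq_ba] := eqVneq b a; first exact: flip.
  rewrite (mate_uniq lab_b neq_ba).
  by apply: connect_trans (alongR (a, i) false) _; apply: flip.
by rewrite cardsX card_lab cardsT card_bool.
Qed.

Definition medial : four_regular :=
  @FourRegular medial_pres medial_regular4 erefl (bare (circ G)).

End Medial.

(* Main.v *)
From mathcomp Require Import all_boot all_fingroup.
Require Import Defs.

Set Implicit Arguments.
Unset Strict Implicit.
Unset Printing Implicit Defensive.

(** Both sides of the equality describe the arrow presentations that are made
    from the arcs of [G] by forgetting how the four arrow ends at each label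
    are grouped into two directed arrows, and grouping them again at will.

    For cycle family graphs this is nearly the definition.  The half-edges of
    the medial graph are the arrow ends of [G], its edges are the arcs of [G],
    and the half-edges at one of its vertices are the four ends at one label
    ([medial_vertex_eq]).  An arrow marked state therefore pairs the four ends
    at each label and directs both pairs, and leaves the arcs alone
    ([Cyc_medialP]).

    For twisted duals there is something to prove ([OrbP]).  A half-twist or a
    partial dual conjugates the arcs by a permutation of the four ends at one
    label, so that a twisted dual has the arcs of [G].  Conversely, let a
    permutation of the four ends be prescribed at each label.  Exchanging the
    two arrows of a label and reversing both of them are isomorphisms; they
    generate the Klein four-group V of the four ends, so that the permutation
    matters only modulo V.  The group of all permutations of the four ends
    acts on V by conjugation with kernel V, hence S_4 / V is the group S_3 of
    automorphisms of V.  Every permutation of V that fixes the identity is an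
    automorphism ([additive_of_inj]), and the half-twist and the partial dual
    act as two distinct transpositions of the nontrivial elements of V, so
    that the words in them give all automorphisms ([word_of_automorphism]). *)

(** * The Klein four-group acting on the ends at each label *)

Definition addp (c d : bool * bool) : bool * bool :=
  (c.1 (+) d.1, c.2 (+) d.2).

(** The first component of [c] exchanges the two arrows of each label, the
    second one reverses them. *)
Definition klein (A : arrow_set) (c : bool * bool) (x : end_of A) : end_of A :=
  (if c.1 then mate x.1 else x.1, x.2 (+) c.2).

Lemma lab_arrow_at (A : arrow_set) (e : label A) : lab (arrow_at e) = e.
Proof. exact/eqP/(xchooseP (label_arrow e)). Qed.

Section Klein.
Variable A : arrow_set.
Implicit Types (x y : end_of A) (c d : bool * bool).

Lemma lab_klein c x : lab (klein c x).1 = lab x.1.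
Proof. by rewrite /klein; case: c.1 => //=; rewrite lab_mate. Qed.

Lemma klein0 x : klein (false, false) x = x.
Proof. by case: x => a i; rewrite /klein /= addbF. Qed.

Lemma kleinD c d x : klein (addp c d) x = klein c (klein d x).
Proof.
case: c d x => [[] i] [[] j] [a k]; rewrite /klein /= ?mateK //;
  by rewrite -addbA (addbC j).
Qed.

Lemma klein_inj x : injective (fun c => klein c x).
Proof.
case: x => a k [i j] [i' j'] [] /= eq_a /addbI ->; congr (_, _).
have /eqP neq := mate_neq a.
by case: i i' eq_a => [] [] // /esym.
Qed.

Lemma klein_orbit x y : lab y.1 = lab x.1 -> exists c, y = klein c x.
Proof.
case: x y => a i [b j] /= lab_ba; exists (b != a, i (+) j).
rewrite /klein /= addKb; congr (_, _).
by case: eqVneq => //= ba; apply: mate_uniq.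
Qed.

End Klein.

(** The sum of all four elements vanishes, hence so does
    [addp (theta c) (addp (theta d) (theta (addp c d)))] as soon as [c] and [d]
    are distinct and nonzero. *)
Lemma additive_of_inj (theta : bool * bool -> bool * bool) :
  injective theta -> theta (false, false) = (false, false) ->
  forall c d, theta (addp c d) = addp (theta c) (theta d).
Proof.
move=> inj_theta theta0.
have neq c d : c != d -> theta c != theta d by rewrite (inj_eq inj_theta).
have := neq (false, true) (false, false) isT.
have := neq (true, false) (false, false) isT.
have := neq (true, true) (false, false) isT.
have := neq (false, true) (true, false) isT.
have := neq (false, true) (true, true) isT.
have := neq (true, false) (true, true) isT.
rewrite theta0 => {inj_theta neq} n1 n2 n3 n4 n5 n6.
move=> [[] []] [[] []]; rewrite /addp /= ?theta0; move: n1 n2 n3 n4 n5 n6;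
  by case: (theta (false, true)) => [[] []];
     case: (theta (true, false)) => [[] []];
     case: (theta (true, true)) => [[] []].
Qed.

(** * Arrow presentations with the same arcs *)

(** The bijection need not map the two ends of an arrow to the two ends of an
    arrow: only the set of ends at each label is preserved. *)
Definition same_arcs (H G : arrow_pres) : Prop :=
  exists phi : end_of H -> end_of G,
    [/\ bijective phi,
        forall x y, (lab (phi x).1 == lab (phi y).1) = (lab x.1 == lab y.1),
        forall x, phi (arc (circ H) x) = arc (circ G) (phi x)
      & bare (circ H) = bare (circ G)].

Lemma same_arcs_trans (H K G : arrow_pres) :
  same_arcs H K -> same_arcs K G -> same_arcs H G.
Proof.
move=> [f [bij_f lab_f arc_f bare_f]] [g [bij_g lab_g arc_g bare_g]].
exists (g \o f); split=> /=; first exact: bij_comp.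
- by move=> x y; rewrite lab_g lab_f.
- by move=> x; rewrite arc_f arc_g.
- by rewrite bare_f.
Qed.

Lemma isomorphic_same_arcs (H K : arrow_pres) :
  isomorphic H K -> same_arcs H K.
Proof.
move=> [fL [fA [r [[gL fLK _] [gA fAK gAK] lab_f arc_f bare_f]]]].
exists (fun x => (fA x.1, x.2 (+) r (lab x.1))); split=> //=.
- exists (fun y => (gA y.1, y.2 (+) r (lab (gA y.1)))) => -[a i] /=.
    by rewrite fAK addbK.
  by rewrite gAK addbK.
- by move=> x y; rewrite !lab_f (can_eq fLK).
Qed.

(** The map of labels is determined by the map of arrows, since every label
    occurs on an arrow. *)
Lemma isomorphic_of_arrows (H K : arrow_pres) (fA : arrow H -> arrow K)
    (r : label H -> bool) (f := fun x => (fA x.1, x.2 (+) r (lab x.1))) :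
    bijective fA ->
    (forall a b, (lab (fA a) == lab (fA b)) = (lab a == lab b)) ->
    (forall x, f (arc (circ H) x) = arc (circ K) (f x)) ->
    bare (circ H) = bare (circ K) ->
  isomorphic H K.
Proof.
move=> bij_f lab_f arc_f bare_f; have [gA fAK gAK] := bij_f.
exists (fun e => lab (fA (arrow_at e))), fA, r; split=> //.
- exists (fun e => lab (gA (arrow_at e))) => e.
    by apply/eqP; rewrite -[eqbRHS]lab_arrow_at -lab_f gAK lab_arrow_at.
  rewrite -[RHS]lab_arrow_at -[in RHS](gAK (arrow_at e)).
  by apply/eqP; rewrite lab_f lab_arrow_at.
- by move=> a; apply/eqP; rewrite lab_f lab_arrow_at.
Qed.

(** Commuting with the Klein four-group forces a map of ends to be induced by
    a map of arrows, up to reversing the two arrows of some labels. *)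
Lemma isomorphic_of_klein (H K : arrow_pres) (g : end_of H -> end_of K) :
    bijective g ->
    (forall x y, (lab (g x).1 == lab (g y).1) = (lab x.1 == lab y.1)) ->
    (forall c x, g (klein c x) = klein c (g x)) ->
    (forall x, g (arc (circ H) x) = arc (circ K) (g x)) ->
    bare (circ H) = bare (circ K) ->
  isomorphic H K.
Proof.
move=> [g' gK g'K] lab_g klein_g arc_g bare_g.
pose fA a := (g (a, false)).1; pose r e := (g (arrow_at e, false)).2.
have gE x : g x = (fA x.1, x.2 (+) r (lab x.1)).
  have lab_x : lab (arrow_at (lab x.1), false).1 = lab x.1.
    exact: lab_arrow_at.
  have [[i j] def_x] := klein_orbit (esym lab_x).
  have := klein_g (false, x.2) (x.1, false).
  rewrite {1}/klein /= -surjective_pairing.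
  move=> ->; rewrite /klein /=; congr (_, _); rewrite addbC; congr (_ (+) _).
  (* Exchanging two arrows keeps the second component, so that the tails of
     both arrows at a label agree on whether they become heads. *)
  have -> : (x.1, false) = klein (i, false) (arrow_at (lab x.1), false).
    by rewrite {1}def_x /klein.
  by rewrite klein_g /= addbF.
apply: (@isomorphic_of_arrows H K fA r) => //.
- exists (fun b => (g' (b, false)).1) => a; last first.
    have := g'K (a, false); rewrite gE => -[def_a _]; exact: def_a.
  have := klein_g (false, (g (a, false)).2) (a, false).
  rewrite /klein /= addbb => E.
  by rewrite /fA -E gK.
- by move=> a b; rewrite lab_g.
- by move=> x; rewrite -!gE arc_g.
Qed.

(** * Cycle family graphs of the medial graph *)

Section Medial.
Variable G : arrow_pres.

Lemma medial_mate (x : arrow (medial G)) : mate x = arc (circ G) x.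
Proof.
apply/esym/mate_uniq; last exact: arc_neq.
by apply: val_inj; rewrite /= arcK setUC.
Qed.

(** The arcs of the medial graph join ends at the same label, so that a vertex
    lies among the four ends at one label; it has four half-edges. *)
Lemma medial_vertex_eq (h k : arrow (medial G)) :
  (vertex_of h == vertex_of k) = (lab h.1 == lab k.1).
Proof.
suff vertexE (x : arrow (medial G)) : vertex_of x
    = [set y : arrow (medial G) | @lab G y.1 == @lab G x.1].
  by rewrite eq_sym -mem_vertex_of vertexE inE eq_sym.
have cardT : #|[set y : arrow (medial G) | @lab G y.1 == @lab G x.1]| = 4.
  have -> : [set y : arrow (medial G) | @lab G y.1 == @lab G x.1]
      = setX [set b | lab b == lab x.1] [set: bool].
    by apply/setP=> -[b j]; rewrite !inE andbT.
  by rewrite cardsX card_lab cardsT card_bool.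
apply/eqP; rewrite eqEcard cardT regular4 leqnn andbT.
apply/subsetP=> y; rewrite !inE; set R := fun _ _ => _ => /connectP[p].
suff labR u v : path R u p -> v = last u p -> @lab G v.1.1 = @lab G u.1.1.
  by move=> path_p last_p; apply/eqP/(labR _ _ path_p last_p).
elim: p u => [|z p IHp] u /=; first by move=> _ ->.
case/andP=> Ruz pz /(IHp z pz) ->.
case/orP: Ruz => /eqP -> //; rewrite /= /medial_arc /across /along /=.
by case: ifP => //=; rewrite lab_mate.
Qed.

Lemma cycle_family_same_arcs (s : arrow_state (medial G)) :
  same_arcs (cycle_family_graph s) G.
Proof.
have halfK : cancel (@half_edge_of _ s) (@end_at _ s).
  exact: (inj_can_sym (@end_atK _ s) (@half_edge_of_inj _ s)).
have vertex_half x : vertex_of (half_edge_of x) = vertex_of (val x.1).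
  by rewrite /half_edge_of; case: x.2; rewrite // pair_vertex.
exists (@half_edge_of _ s); split=> //.
- exact: Bijective halfK (@end_atK _ s).
- by move=> x y; rewrite -medial_vertex_eq !vertex_half -val_eqE.
- by move=> x; rewrite /= end_atK medial_mate.
Qed.

(** The arrows of [H], carried to the ends at the vertices of the medial graph,
    are a marked state: an arrow prescribes a pair of half-edges and which of
    them is at the tail. *)
Section StateOf.
Variables (H : arrow_pres) (phi : end_of H -> end_of G).
Variable psi : end_of G -> end_of H.
Hypotheses (phiK : cancel phi psi) (psiK : cancel psi phi).
Hypothesis lab_phi :
  forall x y, (lab (phi x).1 == lab (phi y).1) = (lab x.1 == lab y.1).

Definition transported_pair (h : arrow (medial G)) : arrow (medial G) :=
  phi ((psi h).1, ~~ (psi h).2).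

Definition transported_tail : pred (arrow (medial G)) :=
  fun h => ~~ (psi h).2.

Lemma transported_pairK : involutive transported_pair.
Proof.
by move=> h; rewrite /transported_pair phiK /= negbK -surjective_pairing psiK.
Qed.

Lemma transported_pair_neq h : transported_pair h != h.
Proof.
rewrite /transported_pair -[eqbRHS]psiK (can_eq phiK).
by case: (psi h) => a i; rewrite xpair_eqE eqxx; case: i.
Qed.

Lemma transported_pair_vertex h : vertex_of (transported_pair h) = vertex_of h.
Proof.
by apply/eqP; rewrite medial_vertex_eq -{2}[h]psiK lab_phi.
Qed.

Lemma transported_tail_pair h :
  transported_tail (transported_pair h) = ~~ transported_tail h.
Proof. by rewrite /transported_tail /transported_pair phiK. Qed.

Definition transported_state : arrow_state (medial G) :=
  ArrowState transported_pairK transported_pair_neq transported_pair_vertex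
             transported_tail_pair.

Lemma transported_at_tail a : at_tail transported_state (phi (a, false)).
Proof. by rewrite /= /transported_tail phiK. Qed.

Definition transported_arrow (a : arrow H) : state_arrow transported_state :=
  exist _ (phi (a, false)) (transported_at_tail a).

Lemma half_edge_transported a i :
  half_edge_of (transported_arrow a, i) = phi (a, i).
Proof.
by rewrite /half_edge_of; case: i; rewrite //= /transported_pair phiK.
Qed.

End StateOf.

Lemma Cyc_medialP (H : arrow_pres) : Cyc (medial G) H <-> same_arcs H G.
Proof.
split=> [[s /isomorphic_same_arcs iso_Hs]|].
  exact: same_arcs_trans iso_Hs (cycle_family_same_arcs s).
move=> [phi [[psi phiK psiK] lab_phi arc_phi bare_phi]].
pose s := transported_state phiK psiK lab_phi.
exists s; pose fA : arrow H -> arrow (cycle_family_graph s) :=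
  transported_arrow phiK psiK lab_phi.
apply: (@isomorphic_of_arrows _ _ fA (fun=> false)) => //.
- exists (fun u : state_arrow s => (psi (val u)).1) => [a|u].
    by rewrite /= phiK.
  apply: val_inj; rewrite /=.
  have /= : at_tail s (val u) := valP u; rewrite /transported_tail => /negPf tl.
  by rewrite -tl -surjective_pairing psiK.
- by move=> a b; rewrite -val_eqE /= medial_vertex_eq lab_phi.
- move=> x; apply: (@half_edge_of_inj _ s).
  rewrite /= end_atK !half_edge_transported !addbF medial_mate.
  by rewrite -!surjective_pairing arc_phi.
Qed.

End Medial.

(** * Twisted duals *)

Section Generators.
Variable A : arrow_set.
Implicit Types (e : label A) (x : end_of A) (w : seq generator).

Definition generator_perm e (g : generator) : {perm end_of A} :=
  match g with
  | Delta => perm (@dual_end_inj A e)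
  | Tau => tperm (arrow_at e, false) (arrow_at e, true)
  end.

(** Permutations multiply from left to right while words act from right to
    left.  Nevertheless the product is in the order of the word: a generator
    conjugates the arcs, so the one applied last is the first to be read on the
    ends of the result. *)
Definition word_perm e w : {perm end_of A} :=
  (\prod_(g <- w) generator_perm e g)%g.

(** The matrices over the field with two elements by which the generators act
    on the Klein four-group. *)
Definition generator_klein (g : generator) (c : bool * bool) : bool * bool :=
  match g with
  | Delta => (c.1 (+) c.2, c.2)
  | Tau => (c.1, c.1 (+) c.2)
  end.

Definition word_klein w (c : bool * bool) : bool * bool :=
  foldl (fun d g => generator_klein g d) c w.

Lemma tauE e x : generator_perm e Tau x
  = if x.1 == arrow_at e then (x.1, ~~ x.2) else x.
Proof.
case: x => a i; rewrite /=; case: eqP => [->|neq_a].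
  by case: i; rewrite ?tpermL ?tpermR.
by rewrite tpermD // xpair_eqE negb_and eq_sym; apply/orP; left; apply/eqP.
Qed.

Lemma lab_generator e g x : lab (generator_perm e g x).1 = lab x.1.
Proof.
case: g; last by rewrite tauE; case: ifP.
by rewrite permE /dual_end; case: ifP; case: x.2; rewrite //= lab_mate.
Qed.

Lemma generator_fix e g x : lab x.1 != e -> generator_perm e g x = x.
Proof.
move=> /negPf neq; case: g; first by rewrite permE /dual_end neq.
rewrite tauE; case: eqP => // def_x.
by move: neq; rewrite def_x lab_arrow_at eqxx.
Qed.

Lemma generator_kleinP e g c x : lab x.1 = e ->
  generator_perm e g (klein c x)
  = klein (generator_klein g c) (generator_perm e g x).
Proof.
move=> lab_x; case: g.
  rewrite !permE /dual_end lab_klein lab_x eqxx /klein.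
  by case: c x {lab_x} => [[] []] [a []]; rewrite //= mateK.
rewrite !tauE /klein; have [def_x|neq_x] := eqVneq x.1 (arrow_at e).
  by rewrite -def_x; case: c x {def_x lab_x} => [[] []] [a []];
    rewrite /= ?eqxx ?(negPf (mate_neq _)).
have -> : arrow_at e = mate x.1.
  by apply: mate_uniq; rewrite ?lab_arrow_at // eq_sym.
by case: c x {neq_x lab_x} => [[] []] [a []];
  rewrite /= ?eqxx // eq_sym (negPf (mate_neq _)).
Qed.

Lemma word_perm_cons e g w :
  word_perm e (g :: w) = (generator_perm e g * word_perm e w)%g.
Proof. exact: big_cons. Qed.

Lemma lab_word e w x : lab (word_perm e w x).1 = lab x.1.
Proof.
elim: w x => [|g w IHw] x; first by rewrite /word_perm big_nil perm1.
by rewrite word_perm_cons permM IHw lab_generator.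
Qed.

Lemma word_fix e w x : lab x.1 != e -> word_perm e w x = x.
Proof.
elim: w x => [|g w IHw] x neq; first by rewrite /word_perm big_nil perm1.
by rewrite word_perm_cons permM generator_fix // IHw.
Qed.

Lemma word_kleinP e w c x : lab x.1 = e ->
  word_perm e w (klein c x) = klein (word_klein w c) (word_perm e w x).
Proof.
elim: w c x => [|g w IHw] c x lab_x; first by rewrite /word_perm big_nil !perm1.
rewrite word_perm_cons !permM generator_kleinP // IHw //.
by rewrite lab_generator.
Qed.

Definition twist_perm (w : label A -> seq generator) (s : seq (label A)) :
  {perm end_of A} := (\prod_(e <- s) word_perm e (w e))%g.

Lemma twist_perm_cons (w : label A -> seq generator) e s :
  twist_perm w (e :: s) = (word_perm e (w e) * twist_perm w s)%g.
Proof. exact: big_cons. Qed.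

Lemma twist_permE (w : label A -> seq generator) (s : seq (label A)) x :
    uniq s ->
  twist_perm w s x
  = if lab x.1 \in s then word_perm (lab x.1) (w (lab x.1)) x else x.
Proof.
elim: s x => [|e s IHs] x /=; first by rewrite /twist_perm big_nil perm1.
move=> /andP[e_s uniq_s]; rewrite twist_perm_cons permM IHs // lab_word inE.
have [->|neq] := eqVneq (lab x.1) e; first by rewrite (negPf e_s).
by rewrite (word_fix _ neq).
Qed.

Lemma arc_act_word e w (C : circles A) x :
  word_perm e w (arc (act_word e w C) x) = arc C (word_perm e w x).
Proof.
elim: w x => [|g w IHw] x; first by rewrite /word_perm big_nil !perm1.
rewrite word_perm_cons !permM -IHw; congr (word_perm e w _).
by rewrite /=; case: g; rewrite /= /replaced_arc permKV.
Qed.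

Lemma bare_act_word e w (C : circles A) : bare (act_word e w C) = bare C.
Proof. by elim: w => [|[] w IHw]. Qed.

Lemma arc_twist (w : label A -> seq generator) s (C : circles A) x :
  twist_perm w s (arc (foldr (fun e => act_word e (w e)) C s) x)
  = arc C (twist_perm w s x).
Proof.
elim: s x => [|e s IHs] x; first by rewrite /twist_perm big_nil !perm1.
by rewrite twist_perm_cons !permM -IHs /= arc_act_word.
Qed.

Lemma bare_twist (w : label A -> seq generator) s (C : circles A) :
  bare (foldr (fun e => act_word e (w e)) C s) = bare C.
Proof. by elim: s => //= e s; rewrite bare_act_word. Qed.

End Generators.

(** An automorphism is determined by the images of the reversal
    [(false, true)] and of the exchange [(true, false)]; the six words are those
    of length at most three that represent the six elements of S_3. *)
Lemma word_of_automorphism (theta : bool * bool -> bool * bool) :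
  injective theta -> theta (false, false) = (false, false) ->
  exists w, word_klein w =1 theta.
Proof.
move=> inj_theta theta0; have thetaD := additive_of_inj inj_theta theta0.
(* Both sides are additive and (false, true), (true, false) are a basis. *)
have [w [wr wm]] : exists w, word_klein w (false, true) = theta (false, true)
                 /\ word_klein w (true, false) = theta (true, false).
  have neq c d : c != d -> theta c != theta d by rewrite (inj_eq inj_theta).
  have := neq (false, true) (false, false) isT.
  have := neq (true, false) (false, false) isT.
  have := neq (false, true) (true, false) isT.
  rewrite theta0; case: (theta (false, true)) => [[] []];
    case: (theta (true, false)) => [[] []] // _ _ _.
  - by exists [:: Delta].
  - by exists [:: Tau; Delta].
  - by exists [:: Delta; Tau].
  - by exists [:: Tau; Delta; Tau].
  - by exists [:: Tau].
  - by exists [::].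
exists w.
have wD c d : word_klein w (addp c d) = addp (word_klein w c) (word_klein w d).
  elim: w c d {wr wm} => //= g w IHw c d; rewrite -IHw.
  by congr (word_klein w _); case: g c d => [] [[] []] [[] []].
have w0 : word_klein w (false, false) = (false, false).
  by elim: w {wr wm wD} => //= -[].
have wl : word_klein w (true, true) = theta (true, true).
  rewrite -[(true, true)]/(addp (true, false) (false, true)).
  by rewrite wD wr wm -thetaD.
by move=> [[] []]; rewrite ?w0.
Qed.

(** Conjugation by a bijection of the four ends at a label normalises the Klein
    four-group.  In coordinates at one end [x0], the bijection is a permutation
    of the Klein group that fixes the identity, and such a permutation is
    additive. *)
Lemma klein_conjugate (H G : arrow_pres) (phi : end_of H -> end_of G)
    (e : label G) :
    bijective phi ->
    (forall x y, (lab (phi x).1 == lab (phi y).1) = (lab x.1 == lab y.1)) ->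
  exists theta : bool * bool -> bool * bool,
    [/\ injective theta, theta (false, false) = (false, false)
      & forall x c, lab (phi x).1 = e ->
          phi (klein c x) = klein (theta c) (phi x)].
Proof.
move=> [psi phiK psiK] lab_phi; pose x0 := psi (arrow_at e, false).
have lab_x0 : lab (phi x0).1 = e by rewrite psiK lab_arrow_at.
have /fin_all_exists[theta thetaP] c :
    exists d, phi (klein c x0) = klein d (phi x0).
  by apply: klein_orbit; apply/eqP; rewrite lab_phi lab_klein.
have inj_theta : injective theta.
  move=> c d eq_cd; apply: (@klein_inj _ x0); apply: (can_inj phiK).
  by rewrite /= !thetaP eq_cd.
have theta0 : theta (false, false) = (false, false).
  by apply: (@klein_inj _ (phi x0)); rewrite /= -thetaP !klein0.
exists theta; split=> // x c lab_x.
have [d ->] : exists d, x = klein d x0.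
  by apply: klein_orbit; apply/eqP; rewrite -lab_phi lab_x lab_x0.
by rewrite -kleinD !thetaP additive_of_inj // kleinD.
Qed.

Lemma OrbP (G H : arrow_pres) : Orb G H <-> same_arcs H G.
Proof.
pose p w := twist_perm w (enum (label G)).
have pE w x : p w x = word_perm (lab x.1) (w (lab x.1)) x.
  by rewrite /p twist_permE ?enum_uniq // mem_enum.
have lab_p w x : lab (p w x).1 = lab x.1 by rewrite pE lab_word.
split=> [[w /isomorphic_same_arcs iso_Hw]|].
  apply: same_arcs_trans iso_Hw _; exists (p w); split=> [|x y|x|] /=.
  - exact: Bijective (permK _) (permKV _).
  - by rewrite !lab_p.
  - exact: arc_twist.
  - exact: bare_twist.
move=> [phi [bij_phi lab_phi arc_phi bare_phi]].
have /fin_all_exists[w wP] e : exists w, forall x c, lab (phi x).1 = e ->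
    phi (klein c x) = klein (word_klein w c) (phi x).
  have [theta [inj_theta theta0 thetaP]] := klein_conjugate e bij_phi lab_phi.
  have [w def_w] := word_of_automorphism inj_theta theta0.
  by exists w => x c lab_x; rewrite thetaP // def_w.
(* After undoing the permutation of the words, what is left of phi commutes with
   the Klein group, so that it is an isomorphism. *)
have lab_pV x : lab ((p w)^-1%g x).1 = lab x.1.
  by rewrite -[in RHS](permKV (p w) x) lab_p.
exists w; pose g : end_of H -> end_of (twist_all w) :=
  fun x => ((p w)^-1)%g (phi x).
apply: (@isomorphic_of_klein _ _ g); rewrite /g.
- apply: bij_comp bij_phi; exact: Bijective (permKV (p w)) (permK _).
- by move=> x y; rewrite !lab_pV lab_phi.
- move=> c x; apply: (@perm_inj _ (p w)); rewrite permKV.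
  rewrite pE lab_klein lab_pV word_kleinP ?lab_pV // -[in RHS]lab_pV.
  by rewrite -pE permKV (wP _ _ _ erefl) lab_pV.
- move=> x; apply: (@perm_inj _ (p w)).
  by rewrite permKV arc_twist permKV arc_phi.
- by rewrite bare_phi bare_twist.
Qed.

Theorem theorem4p10 (G : arrow_pres) :
  forall H : arrow_pres, Cyc (medial G) H <-> Orb G H.
Proof.
by move=> H; split=> [/Cyc_medialP/OrbP|/OrbP/Cyc_medialP].
Qed.
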